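(* Let $(\mathfrak{g},\langle\,,\rangle)$ be a four-dimensional semi-symmetric Lorentzian Lie algebra of type $(S40^1\lambda)$, so that $\mathfrak{g}=\mathfrak{g}_0\oplus\mathfrak{g}_\lambda$ with $\lambda\neq0$ and $\dim\mathfrak{g}_0=1$. Then $\mathfrak{g}.\mathfrak{g}_0=0$, $\mathfrak{g}_\lambda.\mathfrak{g}_\lambda\subset\mathfrak{g}_\lambda$, and hence $\mathfrak{g}$ is the semi-direct product of $\mathfrak{g}_0$ with the three-dimensional pseudo-Euclidean Lie algebra $\mathfrak{g}_\lambda$ of constant curvature, and the action of $\mathfrak{g}_0$ on $\mathfrak{g}_\lambda$ is by a skew-symmetric derivation.
   Context: A pseudo-Euclidean (resp. Lorentzian) Lie algebra is a finite-dimensional real Lie algebra with a nondegenerate inner product (resp. of signature $(1,n-1)$). The Levi-Civita product $u.v=\mathrm{L}_uv$ is defined by $2\langle \mathrm{L}_uv,w\rangle=\langle[u,v],w\rangle+\langle[w,u],v\rangle+\langle[w,v],u\rangle$. The curvature is $K(u,v)=\mathrm{L}_{[u,v]}-[\mathrm{L}_u,\mathrm{L}_v]$, and the Ricci operator is defined by $\langle\mathrm{Ric}(u),v\rangle=\mathrm{tr}(a\mapsto K(u,a)v)$. The Lie algebra is semi-symmetric if $[K(u,v),K(a,b)]=K(K(u,v)a,b)+K(a,K(u,v)b)$ for all $u,v,a,b$. Put $\mathfrak{g}_0=\ker(\mathrm{Ric}^2)$ and, for $\lambda\neq0$, $\mathfrak{g}_\lambda=\ker(\mathrm{Ric}-\lambda\mathrm{Id})$.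 Type $(S40^1\lambda)$: $\dim\mathfrak{g}=4$ and $\mathfrak{g}=\mathfrak{g}_0\oplus\mathfrak{g}_\lambda$ (orthogonal sum) with $\dim\mathfrak{g}_0=1$, $\mathfrak{g}_0.\mathfrak{g}_\lambda\subset\mathfrak{g}_\lambda$, $\mathfrak{g}_0.\mathfrak{g}_0\subset\mathfrak{g}_0$ and $\lambda\neq0$. *)

(* Defs.v *)
From HB Require Import structures.
From mathcomp Require Import all_boot all_order all_algebra.
From mathcomp Require Import boolp classical_sets reals.
From mathcomp Require Import ring.

Set Implicit Arguments.
Unset Strict Implicit.
Unset Printing Implicit Defensive.

Import Order.TTheory GRing.Theory Num.Theory.
Local Open Scope ring_scope.

Section LieAlgebra.
Variables (R : realType) (V : vectType R).
Implicit Types (br : {bilinear V -> V -> V}) (g : {symmetric V}).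
Implicit Types (A I U : {vspace V}).

Definition is_lie_bracket br : Prop :=
  (forall x, br x x = 0) /\
  (forall x y z, br x (br y z) + br y (br z x) + br z (br x y) = 0).

Definition pseudo_euclidean_lie br g : Prop :=
  is_lie_bracket br /\ nondegenerate g.

(* Signature (1, n - 1) is read as (-, +, ..., +). *)
Definition lorentzian_form g : Prop :=
  exists (e : (\dim {:V}).-tuple V) (i0 : 'I_(\dim {:V})),
    basis_of {:V} e /\
    forall i j, g (tnth e i) (tnth e j) = if i == j then (-1) ^+ (i == i0) else 0.

Definition lorentzian_lie br g : Prop :=
  pseudo_euclidean_lie br g /\ lorentzian_form g.

Definition end_comm (f h : 'End(V)) : 'End(V) := (f \o h)%VF - (h \o f)%VF.

Definition lftrace (f : 'End(V)) : R := \tr (passmx.mxof (vbasis {:V}) (vbasis {:V}) f).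

Definition koszul br g (L : V -> 'End(V)) : Prop := forall u v w,
  2 * g (L u v) w = g (br u v) w + g (br w u) v + g (br w v) u.

(* The map u |-> L_u; it is the unique solution of the defining identity
   when [g] is nondegenerate: see [levi_civitaP] and [levi_civita_unique]. *)
Definition levi_civita br g : V -> 'End(V) :=
  xget (fun=> 0) [set L | koszul br g L]%classic.

Definition curvature br g (u v : V) : 'End(V) :=
  levi_civita br g (br u v) - end_comm (levi_civita br g u) (levi_civita br g v).

Definition ricci_spec br g (r : 'End(V)) : Prop := forall u v,
  g (r u) v = lftrace (linfun (fun a => curvature br g u a v)).

(* Well defined when [g] is nondegenerate: see [ricciP] and [ricci_unique]. *)
Definition ricci br g : 'End(V) := xget 0 [set r | ricci_spec br g r]%classic.

Definition semi_symmetric br g : Prop := forall u v a b,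
  end_comm (curvature br g u v) (curvature br g a b) =
  curvature br g (curvature br g u v a) b + curvature br g a (curvature br g u v b).

Definition ricci_space0 br g : {vspace V} := lker (ricci br g \o ricci br g)%VF.

(* For [lambda != 0] only; the space attached to 0 is [ricci_space0]. *)
Definition ricci_space br g (lambda : R) : {vspace V} :=
  lker (ricci br g - lambda *: \1)%VF.

Definition type_S40_1 br g (lambda : R) : Prop :=
  let L := levi_civita br g in
  let g0 := ricci_space0 br g in
  let gl := ricci_space br g lambda in
  lambda != 0 /\
  \dim {:V} = 4%N /\
  (g0 + gl)%VS = fullv /\ directv (g0 + gl) /\
  {in g0 & gl, forall x y, g x y = 0} /\
  \dim g0 = 1%N /\
  {in g0 & gl, forall x y, L x y \in gl} /\
  {in g0 &, forall x y, L x y \in g0}.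

Definition is_subalgebra br U : Prop := {in U &, forall x y, br x y \in U}.

Definition is_ideal br I : Prop := forall x, {in I, forall y, br x y \in I}.

(* The Lie algebra is the (internal) semi-direct product of the subalgebra [A]
   with the ideal [I]; [A] acts on [I] by [sub_ad]. *)
Definition is_semidirect br A I : Prop :=
  is_subalgebra br A /\ is_ideal br I /\ (A + I)%VS = fullv /\ directv (A + I).

(* K(u,v) = L_[u,v] - [L_u,L_v] is the opposite of the most common convention;
   with this sign, [c] is the sectional curvature. *)
Definition constant_curvature br g : Prop :=
  exists c : R, forall u v w,
    curvature br g u v w = c *: (g u w *: v - g v w *: u).

Definition is_derivation br (D : 'End(V)) : Prop :=
  forall x y, D (br x y) = br (D x) y + br x (D y).

Definition skew_operator g (D : 'End(V)) : Prop := forall x y, g (D x) y = - g x (D y).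

Lemma metric_inj g x y : nondegenerate g -> (forall w, g x w = g y w) -> x = y.
Proof.
move=> /eqP ndg gxy; apply/eqP; rewrite -subr_eq0 -memv0 -ndg.
by apply/mem_orthovP => w _ /=; rewrite linearBl /= gxy subrr.
Qed.

Lemma linfunE_linear (W : vectType R) (f : V -> W) : linear f -> linfun f =1 f.
Proof.
move=> lf.
pose F : {linear V -> W} :=
  HB.pack f (GRing.isSemilinear.Build R V W _ f (GRing.semilinear_linear lf)).
exact: (lfunE F).
Qed.

Lemma metric_represent g (B : V -> V -> R) : nondegenerate g ->
  (forall w, scalar (B^~ w)) -> (forall v, scalar (B v)) ->
  exists r : 'End(V), forall v w, g (r v) w = B v w.
Proof.
move=> ndg Bl Br; pose e := vbasis {:V}.
have eB : basis_of {:V} e by exact: vbasisP.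
pose E (C : V -> V -> R) : 'End(V) :=
  linfun (fun x => passmx.vecof e (\row_i C x e`_i)).
have EE C x : (forall w, scalar (C^~ w)) ->
    E C x = passmx.vecof e (\row_i C x e`_i).
  move=> Cl; apply: linfunE_linear => a y z.
  rewrite -passmx.vecof_linear.
  by congr passmx.vecof; apply/rowP=> j; rewrite !mxE Cl.
have gl w : scalar (g^~ w) by move=> a y z; rewrite linearPl.
have ext (C : V -> V -> R) x y : scalar (C y) ->
    (forall i : 'I_(\dim {:V}), g x e`_i = C y e`_i) -> forall w, g x w = C y w.
  move=> Cr gC w.
  pose F : {scalar V} :=
    HB.pack (C y) (GRing.isSemilinear.Build R V R _ (C y) (GRing.semilinear_linear Cr)).
  rewrite (coord_vbasis (memvf w)) linear_sumr -[C y _]/(F _) linear_sum.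
  by apply: eq_bigr => i _; rewrite linearZr_LR linearZ /= gC.
have kE : lker (E g) == 0%VS.
  apply/lker0P => x y /eqP; rewrite -subr_eq0 -linearB /= EE // passmx.vecof_eq0 //.
  move=> /eqP/rowP E0; apply: (metric_inj ndg); apply: ext => [|i].
    by move=> a u v; rewrite linearPr.
  by have := E0 i; rewrite !mxE linearBl => /eqP; rewrite subr_eq0 => /eqP.
exists ((E g)^-1 \o E B)%VF => v; apply: ext => // i.
have := lker0_lfunVK kE (E B v); rewrite comp_lfunE (EE g) // (EE B) //.
by move=> /(can_inj (passmx.vecofK eB))/rowP/(_ i); rewrite !mxE.
Qed.

Lemma levi_civita_unique br g (L L' : V -> 'End(V)) : nondegenerate g ->
  koszul br g L -> koszul br g L' -> L =1 L'.
Proof.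
move=> ndg kL kL' u; apply/lfunP => v; apply: (metric_inj ndg) => w.
by apply: (mulfI (x := 2)); rewrite ?pnatr_eq0 // kL kL'.
Qed.

Lemma levi_civitaP br g : nondegenerate g -> koszul br g (levi_civita br g).
Proof.
move=> ndg; apply: (xgetPex (fun=> 0)).
have /choice[L kL] (u : V) : exists r : 'End(V), forall v w,
    g (r v) w = 2^-1 * (g (br u v) w + g (br w u) v + g (br w v) u).
  apply: metric_represent => // [w a x y|v a x y].
    by rewrite !(linearPr, linearPl) /=; ring.
  by rewrite !(linearPr, linearPl) /=; ring.
by exists L => u v w; rewrite kL mulrA divff ?mul1r // pnatr_eq0.
Qed.

Lemma levi_civita_linear br g : nondegenerate g -> linear (levi_civita br g).
Proof.
move=> ndg a u u'; apply/lfunP => v; apply: (metric_inj ndg) => w.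
have kL := levi_civitaP br ndg; apply: (mulfI (x := 2)); rewrite ?pnatr_eq0 // kL.
rewrite add_lfunE scale_lfunE [in RHS]linearPl /= mulrDr (mulrCA _ a) !kL.
rewrite [br (_ + _) _]linearPl [br _ (_ + _)]linearPr. rewrite !linearPl. rewrite linearPr /=. ring.
Qed.

Lemma curvatureE br g u v x : curvature br g u v x =
  levi_civita br g (br u v) x - (levi_civita br g u (levi_civita br g v x)
                                 - levi_civita br g v (levi_civita br g u x)).
Proof. by rewrite /curvature /end_comm !lfun_simp /=. Qed.

Lemma curvature_linearl br g v : nondegenerate g ->
  linear (fun u => curvature br g u v).
Proof.
move=> ndg a u u'; have lL := levi_civita_linear br ndg.
apply/lfunP => x; rewrite [RHS]add_lfunE scale_lfunE !curvatureE linearPl !lL.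
rewrite !add_lfunE !scale_lfunE linearP /= !scalerBr !opprB !opprD !addrA.
by rewrite [LHS](ACl (1*3*5*2*4*6)%AC).
Qed.

Lemma curvature_linearr br g u : nondegenerate g -> linear (curvature br g u).
Proof.
move=> ndg a v v'; have lL := levi_civita_linear br ndg.
apply/lfunP => x; rewrite [RHS]add_lfunE scale_lfunE !curvatureE linearPr !lL.
rewrite !add_lfunE !scale_lfunE linearP /= !scalerBr !opprB !opprD !addrA.
by rewrite [LHS](ACl (1*3*5*2*4*6)%AC).
Qed.

Lemma lftraceE (f : 'End(V)) :
  lftrace f = \sum_i coord (vbasis {:V}) i (f (vbasis {:V})`_i).
Proof.
by apply: eq_bigr => i _; rewrite !mxE /= passmx.vecof_delta.
Qed.

Lemma ricci_unique br g (r r' : 'End(V)) : nondegenerate g ->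
  ricci_spec br g r -> ricci_spec br g r' -> r = r'.
Proof.
by move=> ndg sr sr'; apply/lfunP => u; apply: (metric_inj ndg) => v; rewrite sr sr'.
Qed.

Lemma ricciP br g : nondegenerate g -> ricci_spec br g (ricci br g).
Proof.
move=> ndg; apply: (xgetPex 0).
have trE u v : lftrace (linfun (fun a => curvature br g u a v)) =
    \sum_i coord (vbasis {:V}) i (curvature br g u (vbasis {:V})`_i v).
  rewrite lftraceE; apply: eq_bigr => i _; rewrite linfunE_linear // => a x y.
  by rewrite curvature_linearr // add_lfunE scale_lfunE.
apply: metric_represent => // [v a x y|u a x y].
  rewrite !trE mulr_sumr -big_split /=; apply: eq_bigr => i _.
  by rewrite curvature_linearl // add_lfunE scale_lfunE linearP.
rewrite !trE mulr_sumr -big_split /=; apply: eq_bigr => i _.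
by rewrite !linearP.
Qed.

End LieAlgebra.

(* Restrictions to a subspace [U]. The projections [vsproj U] only serve to type
   the values: they act as the identity as soon as [U] is stable under the
   bracket (for [sub_bracket]) or under [br x] (for [sub_ad]). *)
Section Restriction.
Variables (R : realType) (V : vectType R) (U : {vspace V}).
Variables (br : {bilinear V -> V -> V}) (g : {symmetric V}).

Definition sub_bracket (x y : subvs_of U) : subvs_of U :=
  vsproj U (br (vsval x) (vsval y)).

Lemma sub_bracket_bilinear : bilinear_for
  (GRing.Scale.Law.clone _ _ *:%R _) (GRing.Scale.Law.clone _ _ *:%R _)
  sub_bracket.
Proof.
by split=> [z|z] a x y; rewrite /sub_bracket linearP ?linearPl ?linearPr linearP.
Qed.
HB.instance Definition _ := bilinear_isBilinear.Build R (subvs_of U) (subvs_of U)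
  (subvs_of U) _ _ sub_bracket sub_bracket_bilinear.

Definition sub_metric (x y : subvs_of U) : R := g (vsval x) (vsval y).

Lemma sub_metric_bilinear : bilinear_for
  (GRing.Scale.Law.clone _ _ *%R _) (GRing.Scale.Law.clone _ _ (idfun \; *%R) _)
  sub_metric.
Proof.
by split=> [z|z] a x y; rewrite /sub_metric linearP ?linearPl ?linearPr.
Qed.
HB.instance Definition _ := bilinear_isBilinear.Build R (subvs_of U) (subvs_of U)
  R _ _ sub_metric sub_metric_bilinear.

Lemma sub_metric_sym x y : sub_metric x y = (-1) ^+ false * idfun (sub_metric y x).
Proof. exact: hermitian_subproof. Qed.
HB.instance Definition _ := isHermitianSesquilinear.Build R (subvs_of U) false idfun
  sub_metric sub_metric_sym.

Definition sub_ad (x : V) : 'End(subvs_of U) :=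
  linfun (fun u : subvs_of U => vsproj U (br x (vsval u))).

End Restriction.

Arguments sub_bracket {R V} U br x y.
Arguments sub_metric {R V} U g x y.
Arguments sub_ad {R V} U br x.

(* Main.v *)
(* Write g_0 = R e. The curvature K commutes with Ric, so it preserves g_0 and
   g_lambda; being skew it kills e, and pair symmetry gives K(e, .) = 0. On the
   3-dimensional g_lambda the curvature is determined by Ric = lambda, whence
   K(u, v) = (lambda / 2) u /\ v. With A u = L_u e, the second Bianchi identity
   on (u, v, e) reads A u /\ v + u /\ A v = 0, which forces A = 0; everything
   else follows from L being skew and torsion free. *)
Require Import Defs.
From HB Require Import structures.
From mathcomp Require Import all_boot all_order all_algebra.
From mathcomp Require Import boolp reals.
From mathcomp Require Import ring lra.

Set Implicit Arguments.
Unset Strict Implicit.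
Unset Printing Implicit Defensive.

Import Order.TTheory GRing.Theory Num.Theory.
Local Open Scope ring_scope.

(** * Orthogonal expansions and traces for an indefinite metric *)

Section OrthogonalExpansion.
Context {R : realType} {V : vectType R}.
Implicit Types (g : {symmetric V}) (f : 'End(V)) (U : {vspace V}) (s : seq V).

Lemma metricC g x y : g x y = g y x.
Proof. by rewrite (hermC g) expr0 mul1r. Qed.

Lemma metricDl g x y z : g (x + y) z = g x z + g y z.
Proof. exact: linearDl. Qed.

Lemma metricDr g x y z : g x (y + z) = g x y + g x z.
Proof. exact: linearDr. Qed.

Lemma metricNl g x y : g (- x) y = - g x y.
Proof. exact: linearNl. Qed.

Lemma metricNr g x y : g x (- y) = - g x y.
Proof. exact: linearNr. Qed.

Lemma metricZl g k x y : g (k *: x) y = k * g x y.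
Proof. exact: linearZl_LR. Qed.

Lemma metricZr g k x y : g x (k *: y) = k * g x y.
Proof. exact: linearZr_LR. Qed.

Lemma metric0l g x : g 0 x = 0.
Proof. exact: linear0l. Qed.

Lemma metric0r g x : g x 0 = 0.
Proof. exact: linear0r. Qed.

Definition metricE := (metricDl, metricDr, metricNl, metricNr, metricZl, metricZr,
  metric0l, metric0r).

Definition nondegenerate_on g U : Prop :=
  {in U, forall x, {in U, forall y, g x y = 0} -> x = 0}.

(** By polarization: if [g x x] vanished on all of [U], then so would [g x y], and nondegeneracy
    would make [U] zero. *)
Lemma exists_nonnull g U : nondegenerate_on g U -> (0 < \dim U)%N ->
  exists2 x, x \in U & g x x != 0.
Proof.
move=> ndU dU; apply: contrapT => nex.
have null x : x \in U -> g x x = 0.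
  by move=> xU; apply/eqP/negPn/negP => gx; apply: nex; exists x.
suff U0 : U = 0%VS by rewrite U0 dimv0 in dU.
apply/eqP; rewrite -subv0; apply/subvP => x xU; rewrite memv0.
apply/eqP/ndU => // y yU; have := null _ (memvD xU yU).
rewrite !metricE (null _ xU) (null _ yU) (metricC g y x) => h; lra.
Qed.

(** The vectors are not normalised, so neither square roots nor signs of [g a a] have to be
    tracked. *)
Definition expands_on g U s : Prop :=
  {in U, forall v, v = \sum_(a <- s) (g v a / g a a) *: a}.

(** Gram-Schmidt by induction on the dimension. Since null vectors may exist, each stage picks a
    non-null [x] and passes to the orthogonal complement of [x] in [U], which is again
    nondegenerate. *)
Lemma orthogonal_expansion g U : nondegenerate_on g U ->
  exists s, [/\ size s = \dim U, {subset s <= U}, {in s, forall a, g a a != 0},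
    pairwise (fun a b => g a b == 0) s & expands_on g U s].
Proof.
have [n] := ubnP (\dim U); elim: n U => // n IHn U dU ndU.
have [/eqP U0|Upos] := posnP (\dim U).
  exists [::]; split=> //; first by rewrite (eqP U0).
  by move=> v; move: U0; rewrite dimv_eq0 => /eqP -> /[!memv0]/eqP->; rewrite big_nil.
have [x xU gx] := exists_nonnull ndU Upos.
have /eq_dim_orthov1 dU' : x \notin orthov g U by apply/mem_orthovPn; exists x.
set U' := (U :&: orthov g <[x]>)%VS in dU'.
have memU' y : y \in U' = (y \in U) && (g y x == 0).
  by rewrite memv_cap mem_orthov1.
have projU' y : y \in U -> y - (g y x / g x x) *: x \in U'.
  move=> yU; rewrite memU' memvB ?memvZ //= !metricE /=.
  by rewrite divfK // subrr.
have ndU' : nondegenerate_on g U'.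
  move=> y; rewrite memU' => /andP[yU /eqP gyx] y0; apply: ndU => // z zU.
  have := y0 _ (projU' z zU).
  by rewrite !metricE /= gyx mulr0 subr0.
have [|s [ss sU' sn sp se]] := IHn U' _ ndU'.
  by rewrite -dU' -ltnS prednK.
have sU a : a \in s -> a \in U /\ g a x = 0.
  by move=> /sU'; rewrite memU' => /andP[? /eqP].
exists (x :: s); split.
- by rewrite /= ss -dU' prednK.
- by move=> a /[!inE] /predU1P[->//|/sU[]].
- by move=> a /[!inE] /predU1P[->//|/sn].
- rewrite /= sp andbT; apply/allP => a /sU[_]; by rewrite metricC => ->.
- move=> v vU; rewrite big_cons; have := se _ (projU' v vU).
  move/eqP; rewrite subr_eq addrC => /eqP {1}->; congr (_ + _).
  apply: eq_big_seq => a /sU[_ ax]; congr (_ *: _).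
  by rewrite !metricE /= metricC -(metricC g a) ax mulr0 subr0 metricC.
Qed.

(** The expansion writes [f] as a sum of rank-one operators sending [v] to
    [(g (f v) a / g a a) *: a]; each of them has trace [g (f a) a / g a a]. *)
Lemma lftrace_expansion g f s : expands_on g fullv s ->
  lftrace f = \sum_(a <- s) g (f a) a / g a a.
Proof.
move=> es; rewrite lftraceE.
under eq_bigr => i _ do rewrite [f _](es _ (memvf _)) linear_sum.
rewrite exchange_big /=; apply: eq_bigr => a _.
rewrite [X in g (f X)](coord_vbasis (memvf a)) linear_sum linear_sumlz mulr_suml /=.
apply: eq_bigr => i _. rewrite !linearZ /=. by rewrite !metricE /=; ring.
Qed.

Lemma lftrace_comp f h : lftrace (f \o h)%VF = lftrace (h \o f)%VF.
Proof.
have bV := vbasisP {:V}.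
rewrite /lftrace (passmx.mxof_comp _ _ bV).
by rewrite (passmx.mxof_comp _ _ bV) mxtrace_mulC.
Qed.

End OrthogonalExpansion.

(** * Symmetries of the curvature and the two Bianchi identities *)

Section Curvature.
Context {R : realType} {V : vectType R}.
Variables (br : {bilinear V -> V -> V}) (g : {symmetric V}).
Hypotheses (ndg : nondegenerate g) (lie : is_lie_bracket br).
Let L := levi_civita br g.
Let K := curvature br g.
Implicit Types (u v w x y z a b : V).

Lemma bracketC u v : br u v = - br v u.
Proof.
have [alt _] := lie; have := alt (u + v).
by rewrite linearDl !linearDr !alt add0r addr0 => /eqP; rewrite addr_eq0 => /eqP.
Qed.

Lemma levi_civitaDl u v x : L (u + v) x = L u x + L v x.
Proof.
have := levi_civita_linear br ndg 1 u v.
by rewrite !scale1r -/L => ->; rewrite add_lfunE.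
Qed.

Lemma levi_civitaZl k u x : L (k *: u) x = k *: L u x.
Proof.
have := levi_civita_linear br ndg k u 0; rewrite addr0 -/L => ->.
have := levi_civita_linear br ndg 1 0 0; rewrite scaler0 addr0 scale1r -/L.
move=> /eqP; rewrite -subr_eq subrr eq_sym => /eqP ->.
by rewrite addr0 scale_lfunE.
Qed.

Lemma levi_civitaNl u x : L (- u) x = - L u x.
Proof. by rewrite -scaleN1r levi_civitaZl scaleN1r. Qed.

Lemma levi_civita_skew u v w : g (L u v) w = - g v (L u w).
Proof.
have kL := levi_civitaP br ndg.
apply: (mulfI (x := 2)); first by rewrite pnatr_eq0.
rewrite mulrN (metricC g v) !kL (bracketC w v) (bracketC w u) (bracketC v u).
by rewrite !metricE; ring.
Qed.

Lemma levi_civita_torsion u v : br u v = L u v - L v u.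
Proof.
have kL := levi_civitaP br ndg.
apply: (metric_inj ndg) => w; apply: (mulfI (x := 2)); first by rewrite pnatr_eq0.
rewrite !metricE mulrDr mulrN !kL (bracketC v u) (bracketC w v) (bracketC w u).
by rewrite !metricE; ring.
Qed.

Lemma curvatureC u v x : K u v x = - K v u x.
Proof.
rewrite /K !curvatureE -/L (bracketC v u) levi_civitaNl.
by apply: (metric_inj ndg) => w; rewrite !metricE; ring.
Qed.

Lemma curvature_skew u v a b : g (K u v a) b = - g a (K u v b).
Proof.
rewrite /K !curvatureE -/L !metricE !(levi_civita_skew, opprK).
by ring.
Qed.

(** Once the brackets are rewritten through the torsion-free [L], the cyclic sum of [K] is the
    opposite of the Jacobi sum. *)
Lemma first_bianchi u v w : K u v w + K v w u + K w u v = 0.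
Proof.
have [_ jac] := lie.
have E x y z : br x (br y z) = L x (L y z - L z y) - L (br y z) x.
  by rewrite -levi_civita_torsion [LHS]levi_civita_torsion.
have := jac u v w; rewrite !E => jac'.
rewrite /K !curvatureE -/L -[RHS]oppr0 -jac'.
apply: (metric_inj ndg) => z; rewrite !linearB /= !metricE; ring.
Qed.

(** Add the first Bianchi identities for the four cyclic shifts of [(u, b, v, a)]: by skewness in
    each pair of arguments, the sum reduces to twice the difference of the two sides. *)
Lemma curvature_pair u v a b : g (K u v a) b = g (K a b u) v.
Proof.
have B x y z t : g (K x y z) t + g (K y z x) t + g (K z x y) t = 0.
  by rewrite -!metricDl first_bianchi metric0l.
have sk x y z t : g (K x y z) t = - g (K x y t) z.
  by rewrite curvature_skew metricC.
have sw x y z t : g (K x y z) t = - g (K y x z) t by rewrite curvatureC metricNl.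
have := B u b v a; have := B b v a u; have := B v a u b; have := B a u b v.
have := sk u b a v; have := sk b v a u; have := sk v a b u; have := sk a u b v.
have := sk u v a b; have := sw v u b a; have := sw a b v u; have := sk b a v u.
have := sw b a u v.
lra.
Qed.

(** The covariant derivative of [K] in the direction [u], evaluated at [(v, w)] and applied to
    [x]. *)
Definition nabla_curvature u v w x :=
  L u (K v w x) - K v w (L u x) - K (L u v) w x - K v (L u w) x.

Lemma curvatureBl u v w x : K (u - v) w x = K u w x - K v w x.
Proof.
have := curvature_linearl br w ndg (-1) v u.
by rewrite !scaleN1r !(addrC (- _)) -/K => ->; rewrite add_lfunE opp_lfunE.
Qed.

(** The terms in [K (L u v)] pair up into terms in [K (br u v)] because the torsion vanishes. What
    remains cancels by two Jacobi identities, one for commutators of the operators [L u], [L v],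
    [L w] and one for [br]. *)
Lemma second_bianchi u v w x :
  nabla_curvature u v w x + nabla_curvature v w u x + nabla_curvature w u v x = 0.
Proof.
have [_ jac] := lie.
have jac' : L (br (br v w) u) x + L (br (br w u) v) x + L (br (br u v) w) x = 0.
  rewrite !(bracketC (br _ _)) -!levi_civitaDl -!opprD jac levi_civitaNl.
  by have := levi_civitaZl 0 0 x; rewrite !scale0r => ->; rewrite oppr0.
have tor : K (L u v) w x + K v (L u w) x + (K (L v w) u x + K w (L v u) x)
    + (K (L w u) v x + K u (L w v) x)
   = K (br v w) u x + K (br w u) v x + K (br u v) w x.
  rewrite !levi_civita_torsion !curvatureBl (curvatureC v (L u w)).
  rewrite (curvatureC w (L v u)) (curvatureC u (L w v)).
  by apply: (metric_inj ndg) => z; rewrite !metricE; ring.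
transitivity (L u (K v w x) - K v w (L u x) + (L v (K w u x) - K w u (L v x))
  + (L w (K u v x) - K u v (L w x)) -
  (K (L u v) w x + K v (L u w) x + (K (L v w) u x + K w (L v u) x)
    + (K (L w u) v x + K u (L w v) x))).
  by apply: (metric_inj ndg) => z; rewrite /nabla_curvature !metricE; ring.
rewrite tor /K !curvatureE -/L.
apply: (metric_inj ndg) => z; have := congr1 (fun t => g t z) jac'.
rewrite !linearB /= !metricE => jacz; rewrite -[RHS]oppr0 -jacz; ring.
Qed.

End Curvature.

(** * Orthogonal frames of a three-dimensional nondegenerate subspace *)

Section OrthogonalFrame.
Context {R : realType} {V : vectType R}.
Implicit Types (g : {symmetric V}) (U : {vspace V}).

(** The conditions are listed cyclically. With a rotation and a swap, every reordering of a frame is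
    a frame, so that one computation serves all pairs of frame vectors. *)
Record orthogonal_frame g U (x y z : V) : Prop := OrthogonalFrame {
  frame_mem : [/\ x \in U, y \in U & z \in U];
  frame_orthogonal : [/\ g x y = 0, g y z = 0 & g z x = 0];
  frame_nonnull : [/\ g x x != 0, g y y != 0 & g z z != 0];
  frame_expansion : {in U, forall v,
    v = (g v x / g x x) *: x + (g v y / g y y) *: y + (g v z / g z z) *: z} }.

Lemma orthogonal_frame_rot g U x y z :
  orthogonal_frame g U x y z -> orthogonal_frame g U y z x.
Proof.
case=> -[xU yU zU] [xy yz zx] [xx yy zz] e; split=> // v vU.
by rewrite {1}(e v vU) -addrA addrC.
Qed.

Lemma orthogonal_frame_swap g U x y z :
  orthogonal_frame g U x y z -> orthogonal_frame g U y x z.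
Proof.
case=> -[xU yU zU] [xy yz zx] [xx yy zz] e; split=> //.
  by split; rewrite metricC.
by move=> v vU; rewrite {1}(e v vU) [_ *: x + _]addrC.
Qed.

Lemma orthogonal_frame_exists g U : nondegenerate_on g U -> \dim U = 3%N ->
  exists x y z, orthogonal_frame g U x y z.
Proof.
move=> ndU dU; have [s [ss sU sn sp se]] := orthogonal_expansion ndU.
rewrite {}dU in ss; case: s ss sU sn sp se => [|x [|y [|z []]]] //= _ sU sn.
rewrite !andbT => /andP[/andP[/eqP xy /eqP xz] /eqP yz] se.
exists x, y, z; split.
- by split; apply: sU; rewrite !inE eqxx ?orbT.
- by split; rewrite // metricC.
- by split; apply: sn; rewrite !inE eqxx ?orbT.
- by move=> v vU; rewrite {1}(se v vU) !big_cons big_nil addr0 addrA.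
Qed.

Lemma orthogonal_frame_inj g U x y z v w : orthogonal_frame g U x y z ->
  v \in U -> w \in U -> g v x = g w x -> g v y = g w y -> g v z = g w z -> v = w.
Proof.
move=> F vU wU hx hy hz.
by rewrite (frame_expansion F vU) hx hy hz -(frame_expansion F wU).
Qed.

End OrthogonalFrame.

(** * Commutation of the Ricci operator with the curvature *)

Section RicciCommutation.
Context {R : realType} {V : vectType R}.
Variables (br : {bilinear V -> V -> V}) (g : {symmetric V}).
Hypotheses (ndg : nondegenerate g) (lie : is_lie_bracket br).
Let K := curvature br g.

Lemma curvature_linfunE u v :
  linfun (fun a => K u a v) =1 (fun a => K u a v).
Proof.
apply: linfunE_linear => k a b.
by rewrite /K curvature_linearr // add_lfunE scale_lfunE.
Qed.

Lemma lftraceD (f h : 'End(V)) : lftrace (f + h) = lftrace f + lftrace h.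
Proof.
rewrite !lftraceE -big_split; apply: eq_bigr => i _ /=.
by rewrite add_lfunE linearD.
Qed.

Lemma lftraceN (f : 'End(V)) : lftrace (- f) = - lftrace f.
Proof.
rewrite !lftraceE -sumrN; apply: eq_bigr => i _ /=.
by rewrite opp_lfunE linearN.
Qed.

(* Since [K u v] acts as a derivation on [K], the sum of the traces of
   [K (K u v a) _ b] and [K a _ (K u v b)] is the trace of a commutator. *)
Lemma ricci_curvature_comm : semi_symmetric br g ->
  forall u v a, ricci br g (K u v a) = K u v (ricci br g a).
Proof.
move=> semi u v a; apply: (metric_inj ndg) => b.
have ricE := ricciP br ndg.
rewrite /K curvature_skew // -/K !ricE -/K.
apply/eqP; rewrite -subr_eq0 opprK -lftraceD; apply/eqP.
set X := K u v; set f := linfun (fun c => K a c b).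
transitivity (lftrace ((X \o f)%VF - (f \o X)%VF)).
  congr lftrace; apply/lfunP => c.
  have : X (K a c b) - K a c (X b) = K (X a) c b + K a (X c) b.
    have := congr1 (fun h : 'End(V) => h b) (semi u v a c).
    by rewrite /= /end_comm add_lfunE opp_lfunE !comp_lfunE => ->; rewrite add_lfunE.
  move=> /eqP; rewrite subr_eq => /eqP der.
  rewrite [LHS]add_lfunE [RHS]add_lfunE opp_lfunE !comp_lfunE /f !curvature_linfunE der.
  by rewrite [X in X - _]addrAC addrK.
by rewrite lftraceD lftraceN lftrace_comp subrr.
Qed.

End RicciCommutation.

(** * The line spanned by [e] and the curvature of its orthogonal complement [U] *)

Section ParallelLine.
Context {R : realType} {V : vectType R}.
Variables (br : {bilinear V -> V -> V}) (g : {symmetric V}) (lambda : R).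
Hypotheses (ndg : nondegenerate g) (lie : is_lie_bracket br).
Let L := levi_civita br g.
Let K := curvature br g.
Variables (e : V) (U : {vspace V}).
Hypotheses (ee : g e e != 0) (memU : forall v, (v \in U) = (g v e == 0)).
Hypotheses (dimU : \dim U = 3%N) (lambda0 : lambda != 0).
Hypotheses (Lee : L e e = 0) (Ke : forall u v, K u v e = 0).
Hypothesis ricU : {in U &, forall u v, g (ricci br g u) v = lambda * g u v}.

Let split_line v : exists k, exists2 p, p \in U & v = k *: e + p.
Proof.
exists (g v e / g e e), (v - (g v e / g e e) *: e); last by rewrite addrC subrK.
by rewrite memU !metricE divfK // subrr.
Qed.

Let gUe x : x \in U -> g x e = 0.
Proof. by rewrite memU => /eqP. Qed.

Let geU x : x \in U -> g e x = 0.
Proof. by rewrite metricC; exact: gUe. Qed.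

Lemma line_complement_nondegenerate : nondegenerate_on g U.
Proof.
move=> x xU x0; apply: (metric_inj ndg) => w; rewrite metric0l.
by have [k [p pU ->]] := split_line w; rewrite !metricE gUe // x0 // mulr0 addr0.
Qed.

Let KU u v x : K u v x \in U.
Proof. by rewrite memU /K curvature_skew // -/K Ke metric0r oppr0. Qed.

Let Kel v x : K e v x = 0.
Proof.
apply: (metric_inj ndg) => b; rewrite /K curvature_pair // -/K Ke.
by rewrite !metric0l.
Qed.

Let Ker v x : K v e x = 0.
Proof. by rewrite /K curvatureC // -/K Kel oppr0. Qed.

Let sk u v a b : g (K u v a) b = - g (K u v b) a.
Proof. by rewrite /K curvature_skew // metricC. Qed.

Let sw u v a b : g (K u v a) b = - g (K v u a) b.
Proof. by rewrite /K curvatureC // metricNl. Qed.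

Let Kuu u a b : g (K u u a) b = 0.
Proof. by have := sw u u a b; lra. Qed.

Let Kaa u v a : g (K u v a) a = 0.
Proof. by have := sk u v a a; lra. Qed.

(** The trace is taken along [e, x, y, z]; the term of [e] drops out because [K u e = 0]. *)
Lemma ricci_frame x y z : orthogonal_frame g U x y z -> {in U &, forall u v,
  lambda * g u v =
    g (K u x v) x / g x x + g (K u y v) y / g y y + g (K u z v) z / g z z}.
Proof.
move=> F u v uU vU; have [[xU yU zU] _ _ E] := F.
rewrite -ricU // (ricciP br ndg).
have ex : expands_on g fullv [:: e; x; y; z].
  move=> w _; rewrite !big_cons big_nil addr0.
  have [k [p pU ->]] := split_line w.
  rewrite !metricE (gUe pU) (geU xU) (geU yU) (geU zU) addr0 !mulr0 !add0r mulfK //.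
  by rewrite {1}(E p pU) !addrA.
rewrite (lftrace_expansion _ ex) !big_cons big_nil.
rewrite !(curvature_linfunE br ndg) -/K Ker metric0l.
by rewrite mul0r add0r addr0 addrA.
Qed.

(** In the Ricci identity at the orthogonal pair [(y, z)], skewness leaves only the term of [x]. *)
Lemma frame_offdiagonal x y z : orthogonal_frame g U x y z -> g (K x y x) z = 0.
Proof.
move=> F; have [[xU yU zU] [xy yz zx] [xx yy zz] _] := F.
have := ricci_frame F yU zU; rewrite yz mulr0 Kuu Kaa !mul0r !addr0 => /esym/eqP.
rewrite mulf_eq0 invr_eq0 (negPf xx) orbF => /eqP.
by rewrite sk sw => /eqP; rewrite !oppr_eq0 => /eqP.
Qed.

Lemma frame_ricci_diagonal x y z : orthogonal_frame g U x y z ->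
  lambda = g (K x y x) y / (g x x * g y y) + g (K x z x) z / (g x x * g z z).
Proof.
move=> F; have [[xU yU zU] [xy yz zx] [xx yy zz] _] := F.
apply: (mulIf xx); rewrite (ricci_frame F xU xU) Kuu; field.
by apply/and3P.
Qed.

(** This is where dimension three enters: the three sectional curvatures of the frame planes have
    pairwise sums [lambda], so each of them is [lambda / 2]. *)
Lemma frame_diagonal x y z : orthogonal_frame g U x y z ->
  g (K x y x) y = lambda / 2 * (g x x * g y y).
Proof.
move=> F; have [_ _ [xx yy zz] _] := F.
have h1 := frame_ricci_diagonal F.
have h2 := frame_ricci_diagonal (orthogonal_frame_rot F).
have h3 := frame_ricci_diagonal (orthogonal_frame_rot (orthogonal_frame_rot F)).
have sym a b : g (K a b a) b = g (K b a b) a.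
  by rewrite sk sw opprK.
rewrite (sym z) (sym z) (mulrC (g z z)) (mulrC (g z z)) in h3.
rewrite (sym y x) (mulrC (g y y) (g x x)) in h2.
suff -> : lambda / 2 = g (K x y x) y / (g x x * g y y) by rewrite divfK // mulf_neq0.
lra.
Qed.

(** The preceding lemmas give all components of [K x y x], and a swap gives [K x y y]. Then
    [K x y z = 0], since skewness turns its components into those of these two vectors along [z]. *)
Lemma frame_curvature x y z : orthogonal_frame g U x y z ->
  {in U, forall w, K x y w = (lambda / 2) *: (g x w *: y - g y w *: x)}.
Proof.
have Kxyx a b c : orthogonal_frame g U a b c -> K a b a = (lambda / 2 * g a a) *: b.
  move=> F; have [[aU bU cU] [ab bc ca] _ _] := F.
  apply: (orthogonal_frame_inj F); rewrite ?KU ?memvZ // metricZl.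
  - by rewrite Kaa metricC ab mulr0.
  - by rewrite (frame_diagonal F) mulrA.
  - by rewrite (frame_offdiagonal F) bc mulr0.
move=> F w wU; have [[xU yU zU] [xy yz zx] _ _] := F.
have F' := orthogonal_frame_swap F.
have Kxyy : K x y y = - ((lambda / 2 * g y y) *: x).
  by rewrite -(Kxyx _ _ _ F') /K curvatureC.
have Kxyz : K x y z = 0.
  apply: (orthogonal_frame_inj F); rewrite ?KU ?mem0v // metric0l ?Kaa //.
    by rewrite sk (Kxyx _ _ _ F) metricZl yz mulr0 oppr0.
  by rewrite sk Kxyy metricNl metricZl (metricC g x) zx mulr0 !oppr0.
have yx : g y x = 0 by rewrite metricC.
have xz : g x z = 0 by rewrite metricC.
apply: (orthogonal_frame_inj F); rewrite ?KU ?memvZ ?memvB ?memvZ // !metricE sk.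
- by rewrite (Kxyx _ _ _ F) metricZl yx; ring.
- by rewrite Kxyy !metricE xy; ring.
- by rewrite Kxyz yz xz metric0l; ring.
Qed.

(** Both sides are bilinear and alternating in [u] and [v], so it suffices to compare them on the
    ordered pairs of distinct frame vectors. *)
Lemma line_complement_curvature u v w : u \in U -> v \in U -> w \in U ->
  K u v w = (lambda / 2) *: (g u w *: v - g v w *: u).
Proof.
move=> uU vU wU.
have [x [y [z F]]] := orthogonal_frame_exists line_complement_nondegenerate dimU.
have KPl k a b c : K (k *: a + b) c w = k *: K a c w + K b c w.
  by rewrite /K curvature_linearl // add_lfunE scale_lfunE.
have KPr k a b c : K c (k *: a + b) w = k *: K c a w + K c b w.
  by rewrite /K curvature_linearr // add_lfunE scale_lfunE.
have KZl k a c : K (k *: a) c w = k *: K a c w.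
  (* The instance with [k = -1] and zero vectors yields [K 0 c w = 0]. *)
  have := KPl k a 0 c; have := KPl (-1) 0 0 c.
  rewrite !addr0 scaler0 scaleN1r addNr => ->.
  by rewrite addr0.
have KZr k a c : K c (k *: a) w = k *: K c a w.
  have := KPr k a 0 c; have := KPr (-1) 0 0 c.
  rewrite !addr0 scaler0 scaleN1r addNr => ->.
  by rewrite addr0.
have E t : t \in U -> exists a b c, t = a *: x + (b *: y + c *: z).
  by move=> tU; do 3 eexists; rewrite addrA; apply: (frame_expansion F).
have [a1 [b1 [c1 ->]]] := E u uU; have [a2 [b2 [c2 ->]]] := E v vU.
have K0 a : K a a w = 0 by apply: (metric_inj ndg) => t; rewrite Kuu metric0l.
have F1 := orthogonal_frame_rot F; have F2 := orthogonal_frame_rot F1.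
have fc := frame_curvature.
rewrite !(KPl, KPr, KZl, KZr) !K0.
rewrite (fc _ _ _ F) // (fc _ _ _ F1) // (fc _ _ _ F2) //.
rewrite (fc _ _ _ (orthogonal_frame_swap F)) // (fc _ _ _ (orthogonal_frame_swap F1)) //.
rewrite (fc _ _ _ (orthogonal_frame_swap F2)) //.
by apply: (metric_inj ndg) => t; rewrite !metricE; ring.
Qed.

Let LeU u : L u e \in U.
Proof.
rewrite memU; have := levi_civita_skew ndg lie u e e.
by rewrite metricC -/L => h; apply/eqP; lra.
Qed.

(** In the second Bianchi identity for [(u, v, e)], a term with [e] as an argument of [K] vanishes,
    so only those with [L u e] or [L v e] survive besides the derivative along [e]. *)
Lemma bianchi_line u v w : u \in U -> v \in U -> w \in U ->
  K (L u e) v w + K u (L v e) w = 0.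
Proof.
move=> uU vU wU; have := second_bianchi ndg lie u v e w.
have LU x : x \in U -> L e x \in U.
  by rewrite !memU => /eqP xe; rewrite /L levi_civita_skew // -/L Lee metric0r oppr0.
have n1 : nabla_curvature br g u v e w = K (L u e) v w.
  rewrite /nabla_curvature -/L -/K !Ker linear0 !subr0 sub0r.
  by rewrite [RHS]curvatureC.
have n2 : nabla_curvature br g v e u w = - K (L v e) u w.
  by rewrite /nabla_curvature -/L -/K !Kel linear0 !subr0 sub0r.
(* On [U] the curvature is built from [g] alone, and [L e] is skew and preserves [U]; hence its
   derivative along [e] is zero. *)
have n3 : nabla_curvature br g e u v w = 0.
  rewrite /nabla_curvature -/L -/K !line_complement_curvature ?LU //.
  have s a b : g (L e a) b = - g a (L e b) by rewrite /L levi_civita_skew.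
  rewrite linearZ linearB /= !linearZ /= !s.
  by apply: (metric_inj ndg) => t; rewrite !metricE; ring.
by rewrite n1 n2 n3 addr0 [K u _ w]curvatureC.
Qed.

(* [A u := L u e] satisfies [A u /\ v + u /\ A v = 0] in the exterior square of
   a space of dimension 3, which forces [A = 0]. *)
Lemma levi_civita_line u : L u e = 0.
Proof.
have [x [y [z F]]] := orthogonal_frame_exists line_complement_nondegenerate dimU.
pose A u := L u e.
have wedge a b w t : a \in U -> b \in U -> w \in U ->
  g (A a) w * g b t - g b w * g (A a) t + (g a w * g (A b) t - g (A b) w * g a t) = 0.
  move=> aU bU wU; have := bianchi_line aU bU wU.
  rewrite !line_complement_curvature ?LeU // -scalerDr => /eqP.
  rewrite scaler_eq0 mulf_eq0 (negPf lambda0) invr_eq0 pnatr_eq0 /=.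
  by move=> /eqP/(congr1 (g^~ t)); rewrite !metricE.
have off a b c : orthogonal_frame g U a b c -> g (A a) c = 0.
  move=> F'; have [[aU bU cU] [ab bc ca] [aa bb cc] _] := F'.
  (* Taking [w = c] and [t = b] isolates the component of [A a] along [c]. *)
  have := wedge a b c b aU bU cU.
  rewrite bc (metricC g a c) ca ab !(mul0r, mulr0, subr0, addr0) => /eqP.
  by rewrite mulf_eq0 (negPf bb) orbF => /eqP.
have diag a b c : orthogonal_frame g U a b c -> g (A a) a / g a a + g (A b) b / g b b = 0.
  move=> F'; have [[aU bU cU] [ab bc ca] [aa bb cc] _] := F'.
  have := wedge a b a b aU bU aU.
  rewrite ab (metricC g b a) ab !(mul0r, mulr0, subr0, addr0) => h.
  by rewrite addf_div // (mulrC (g (A b) b)) h mul0r.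
have A0 a b c : orthogonal_frame g U a b c -> A a = 0.
  move=> F'; have [_ _ [aa _ _] _] := F'.
  have F1 := orthogonal_frame_rot F'; have F2 := orthogonal_frame_rot F1.
  (* Three numbers whose pairwise sums vanish are all zero. *)
  have h : g (A a) a / g a a = 0 by 
    by have := diag _ _ _ F'; have := diag _ _ _ F1; have := diag _ _ _ F2; lra.
  apply: (orthogonal_frame_inj F'); rewrite ?LeU ?mem0v // metric0l.
  - by rewrite -[LHS](divfK aa) h mul0r.
  (* The reordered frame is [(a, c, b)], which gives the component along [b]. *)
  - exact: off (orthogonal_frame_rot (orthogonal_frame_rot (orthogonal_frame_swap F1))).
  - exact: off F'.
have F1 := orthogonal_frame_rot F; have F2 := orthogonal_frame_rot F1.
have [k [p pU ->]] := split_line u.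
rewrite (frame_expansion F pU) /L !levi_civitaDl // !levi_civitaZl // -/L Lee.
by rewrite -!/(A _) (A0 _ _ _ F) (A0 _ _ _ F1) (A0 _ _ _ F2) !scaler0 !addr0.
Qed.

End ParallelLine.

(** * Restriction of the connection and curvature to a totally geodesic subspace *)

Section TotallyGeodesic.
Context {R : realType} {V : vectType R}.
Variables (br : {bilinear V -> V -> V}) (g : {symmetric V}) (U : {vspace V}).
Hypotheses (ndg : nondegenerate g) (lie : is_lie_bracket br).
Hypothesis ndU : nondegenerate_on g U.
Hypothesis LU : forall u v, u \in U -> v \in U -> levi_civita br g u v \in U.
Let subvsK (x : V) : x \in U -> vsval (vsproj U x) = x := @vsprojK _ _ U x.

Lemma vsval_sub_bracket x y :
  vsval (sub_bracket U br x y) = br (vsval x) (vsval y).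
Proof.
rewrite /sub_bracket subvsK // (levi_civita_torsion ndg lie).
by rewrite memvB ?LU ?subvsP.
Qed.

Lemma sub_metric_nondegenerate : nondegenerate (sub_metric U g).
Proof.
rewrite /nondegenerate -subv0; apply/subvP => x /mem_orthovP x0; rewrite memv0.
apply/eqP/subvs_inj; rewrite linear0; apply: ndU; rewrite ?subvsP // => y yU.
by have := x0 (vsproj U y) (memvf _); rewrite /= /sub_metric subvsK.
Qed.

Lemma sub_bracket_lie : is_lie_bracket (sub_bracket U br).
Proof.
have [alt jac] := lie; split=> [x|x y z]; apply: subvs_inj.
  by rewrite vsval_sub_bracket alt linear0.
by rewrite !linearD /= !vsval_sub_bracket jac.
Qed.

(** The restriction of [L] to [U] satisfies the Koszul identity of the restricted data, so
    uniqueness identifies it with their Levi-Civita product. *)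
Lemma vsval_sub_levi_civita x y :
  vsval (levi_civita (sub_bracket U br) (sub_metric U g) x y)
  = levi_civita br g (vsval x) (vsval y).
Proof.
pose L' (u : subvs_of U) : 'End(subvs_of U) :=
  linfun (fun v => vsproj U (levi_civita br g (vsval u) (vsval v))).
have L'E u v : vsval (L' u v) = levi_civita br g (vsval u) (vsval v).
  rewrite linfunE_linear ?subvsK ?LU ?subvsP // => k a b.
  by rewrite !linearP.
have nd := sub_metric_nondegenerate.
suff kL' : koszul (sub_bracket U br) (sub_metric U g) L'.
  by rewrite (levi_civita_unique nd (levi_civitaP _ nd) kL').
move=> u v w; rewrite /= /sub_metric L'E !vsval_sub_bracket.
exact: levi_civitaP.
Qed.

Lemma vsval_sub_curvature x y z :
  vsval (curvature (sub_bracket U br) (sub_metric U g) x y z)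
  = curvature br g (vsval x) (vsval y) (vsval z).
Proof.
by rewrite !curvatureE !linearB /= !vsval_sub_levi_civita vsval_sub_bracket.
Qed.

End TotallyGeodesic.

(** * The orthogonal splitting and the semi-direct product structure *)

Unset Implicit Arguments.

Theorem proposition5p5 (R : realType) (V : vectType R)
    (br : {bilinear V -> V -> V}) (g : {symmetric V}) (lambda : R)
    (hLorentz : lorentzian_lie br g)
    (hsemi : semi_symmetric br g)
    (htype : type_S40_1 br g lambda) :
  let L := levi_civita br g in
  let g0 := ricci_space0 br g in
  let gl := ricci_space br g lambda in
  (forall u v, v \in g0 -> L u v = 0) /\
  (forall u v, u \in gl -> v \in gl -> L u v \in gl) /\
  is_semidirect br g0 gl /\
  \dim gl = 3%N /\
  pseudo_euclidean_lie (sub_bracket gl br) (sub_metric gl g) /\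
  constant_curvature (sub_bracket gl br) (sub_metric gl g) /\
  (forall x, x \in g0 ->
     is_derivation (sub_bracket gl br) (sub_ad gl br x) /\
     skew_operator (sub_metric gl g) (sub_ad gl br x)).
Proof.
case: hLorentz htype => -[lie ndg] _ [lambda0 [dimV [sumV [dirV [orth [dim0 [L0l L00]]]]]]].
move=> L g0 gl; rewrite -/L -/g0 -/gl in sumV dirV orth dim0 L0l L00.
have dimgl : \dim gl = 3%N.
  by move: dirV; rewrite directvE /= sumV dimV dim0 add1n eqSS => /eqP.
pose e := vpick g0.
have e0 : e != 0 by rewrite vpick0 -dimv_eq0 dim0.
have eg0 : e \in g0 by exact: memv_pick.
have g0E : g0 = <[e]>%VS.
  by apply/eqP; rewrite eq_sym eqEdim -memvE eg0 dim0 dim_vline e0.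
have split v : exists k, exists2 p, p \in gl & v = k *: e + p.
  have : v \in (g0 + gl)%VS by rewrite sumV memvf.
  case/memv_addP => a; rewrite g0E => /vlineP[k ->] [p pl ->].
  by exists k, p.
(* A null [e], being orthogonal to [gl] as well, would be orthogonal to the whole space. *)
have ee : g e e != 0.
  apply: contra e0 => /eqP ee; apply/eqP/(metric_inj ndg) => w.
  have [k [p pl ->]] := split w.
  by rewrite metric0l !metricE ee mulr0 add0r orth.
have memgl v : (v \in gl) = (g v e == 0).
  apply/idP/eqP => [vl|]; first by rewrite metricC orth.
  have [k [p pl ->]] := split v; rewrite !metricE (metricC g p) (orth e p) //.
  rewrite addr0 => /eqP; rewrite mulf_eq0 (negPf ee) orbF => /eqP ->.
  by rewrite scale0r add0r.
have skew0 v : v \in g0 -> g v e = 0 -> v = 0.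
  rewrite g0E => /vlineP[k ->] /eqP; rewrite metricE mulf_eq0 (negPf ee) orbF.
  by move=> /eqP ->; rewrite scale0r.
have Lee : L e e = 0.
  apply: skew0; first exact: L00.
  by have := levi_civita_skew ndg lie e e e; rewrite (metricC _ e) -/L => h; lra.
(* Commuting with the Ricci operator, [K u v] preserves the kernel of its square, which is the line
   of [e]; by skewness the image of [e] is also orthogonal to [e]. *)
have Ke u v : curvature br g u v e = 0.
  apply: skew0; last first.
    by have := curvature_skew ndg lie u v e e; rewrite (metricC _ e) => h; lra.
  move: eg0; rewrite !memv_ker !comp_lfunE => /eqP e00.
  by rewrite !ricci_curvature_comm // e00 linear0.
have ricl : {in gl &, forall u v, g (ricci br g u) v = lambda * g u v}.
  move=> u v; rewrite memv_ker add_lfunE opp_lfunE scale_lfunE id_lfunE.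
  by rewrite subr_eq0 => /eqP -> _; rewrite metricE.
have Lline := levi_civita_line ndg lie ee memgl dimgl lambda0 Lee Ke ricl.
have ndl := line_complement_nondegenerate ndg ee memgl.
have L_0 u v : v \in g0 -> L u v = 0.
  by rewrite g0E => /vlineP[k ->]; rewrite linearZ /= /L Lline scaler0.
have Lgl u v : v \in gl -> L u v \in gl.
  by move=> _; rewrite memgl /L levi_civita_skew // Lline metric0r oppr0.
have Lll u v : u \in gl -> v \in gl -> L u v \in gl by move=> _; exact: Lgl.
(* As [L y x = 0], the adjoint action of [g0] coincides with its Levi-Civita action, which is
   skew. *)
have brE x y : x \in g0 -> br x y = L x y.
  by move=> x0; rewrite (levi_civita_torsion ndg lie) -/L (L_0 y) // subr0.
split; [exact: L_0|split; [exact: Lll|split; [|split; [exact: dimgl|split; [|split]]]]].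
- split; first by move=> x y x0 y0; rewrite brE // L_0 // mem0v.
  split; last by [].
  move=> x y yl; rewrite (levi_civita_torsion ndg lie) -/L.
  apply: memvB; first exact: Lgl.
  (* Only the component of [x] in [gl] matters, because [L y e = 0]. *)
  have [k [p pl ->]] := split x.
  by rewrite linearD linearZ /= Lline scaler0 add0r Lgl.
- split; first exact: (sub_bracket_lie ndg lie Lll).
  exact: (sub_metric_nondegenerate ndl).
- exists (lambda / 2) => u v w; apply: subvs_inj.
  rewrite (vsval_sub_curvature ndg lie ndl Lll).
  rewrite (line_complement_curvature ndg lie ee memgl dimgl Ke ricl) ?subvsP //.
- move=> x x0.
  have adE y : vsval (sub_ad gl br x y) = L x (vsval y).
    rewrite linfunE_linear; first by rewrite brE // vsprojK // Lgl ?subvsP.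
    by move=> k a b; rewrite !(linearP, linearPr).
  (* The derivation rule is the Jacobi identity for [x], [y], [z]; skewness is that of [L x]. *)
  split=> y z.
    apply: subvs_inj; rewrite linearD /= adE !(vsval_sub_bracket ndg lie Lll) !adE.
    have [_ jac] := lie; rewrite -!brE //; have := jac x (vsval y) (vsval z).
    rewrite (bracketC lie (vsval z) x) linearNr (bracketC lie (vsval z) (br _ _)).
    by rewrite -addrA -opprD => /eqP; rewrite subr_eq0 addrC => /eqP.
  rewrite /= /sub_metric !adE; exact: levi_civita_skew.
Qed.
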